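(* Let $w=(w_k)_{k\ge0}$ be any weight sequence with $w_0>0$ and $w_k>0$ for some $k\ge2$. Suppose that $n\to\infty$ with $n\equiv1\pmod{\mathrm{span}(w)}$, and let $\tau$ be the unique number in $[0,\rho]$ with $\Psi(\tau)=1$ if $\nu\ge1$, and $\tau=\rho$ if $\nu<1$. Then $$\frac1n\log Z_n\to\log\Phi(\tau)-\log\tau=\log\inf_{0\le t<\infty}\frac{\Phi(t)}{t}\in(-\infty,\infty].$$ The limit is finite if $\rho>0$, and $+\infty$ if $\rho=0$.
   Context: A weight sequence is a sequence $w=(w_k)_{k\ge0}$ of nonnegative reals; $\mathrm{span}(w)$ is the largest $d\ge1$ dividing every $k$ with $w_k>0$. $\Phi(t)=\sum_{k\ge0}w_kt^k$, $\rho\in[0,\infty]$ its radius of convergence; for $t$ with $\Phi(t)<\infty$, $\Psi(t)=t\Phi'(t)/\Phi(t)$; if $\Phi(\rho)=\infty$, $\Psi(\rho)=\lim_{t\uparrow\rho}\Psi(t)$; $\nu=\Psi(\rho)$. $Z_n=\sum_T\prod_{v\in T}w_{d^+_T(v)}$, the sum over all ordered rooted trees $T$ with $n$ nodes, where $d^+_T(v)$ is the number of children of $v$. *)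

(* Defs.v *)
From HB Require Import structures.
From mathcomp Require Import all_boot all_order all_algebra.
From mathcomp Require Import all_classical all_reals all_analysis.
Set Implicit Arguments. Unset Strict Implicit. Unset Printing Implicit Defensive.
Import Order.TTheory GRing.Theory Num.Theory.
Import numFieldNormedType.Exports.
Local Open Scope classical_set_scope.
Local Open Scope ring_scope.

Inductive otree : Type := Node of seq otree.

HB.instance Definition _ := gen_eqMixin otree.
HB.instance Definition _ := gen_choiceMixin otree.

Fixpoint tsize (t : otree) : nat :=
  let: Node ts := t in (foldr (fun s acc => tsize s + acc) 0 ts).+1.

Fixpoint tweight (R : realType) (w : nat -> R) (t : otree) : R :=
  let: Node ts := t in w (size ts) * foldr (fun s acc => tweight w s * acc) 1 ts.

Section Defs.
Variable R : realType.
Variable w : nat -> R.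
Local Open Scope ereal_scope.

Definition Zn (n : nat) : \bar R :=
  \esum_(t in [set t : otree | tsize t = n]) (tweight w t)%:E.

Definition Phi (t : R) : \bar R := \sum_(0 <= k <oo) (w k * t ^+ k)%:E.

Definition tPhi' (t : R) : \bar R := \sum_(0 <= k <oo) (k%:R * w k * t ^+ k)%:E.

(* radius of convergence of Phi (nonnegative coefficients) *)
Definition rho : \bar R :=
  ereal_sup [set t%:E | t in [set t : R | (0 <= t)%R /\ Phi t < +oo]].

(* Psi(t) = t Phi'(t) / Phi(t), for t with Phi(t) < oo *)
Definition Psi (t : R) : \bar R := tPhi' t / Phi t.

Definition nu : \bar R :=
  match rho with
  | r%:E => if Phi r < +oo then Psi r else lim (Psi t @[t --> r^'-])
  | +oo => lim (Psi t @[t --> +oo%R])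
  | -oo => 0
  end.

End Defs.

Definition is_span (R : realType) (w : nat -> R) (d : nat) : Prop :=
  (0 < d)%N /\ (forall k, 0 < w k -> (d %| k)%N) /\
  (forall d', (0 < d')%N -> (forall k, 0 < w k -> (d' %| k)%N) -> (d' <= d)%N).

(* Main.v *)
Require Import Defs.
From HB Require Import structures.
From mathcomp Require Import all_boot all_order all_algebra.
From mathcomp Require Import all_classical all_reals all_analysis.
From Stdlib Require List.
From mathcomp Require Import ring lra zify.
Import Order.TTheory GRing.Theory Num.Theory.
Import numFieldNormedType.Exports.
Local Open Scope classical_set_scope.
Local Open Scope ring_scope.

(** The generating function z(x) = sum_n Z_n x^n satisfies z = x Phi(z).
    Upper bound: if Phi(t) = t B, then, by induction on the height h, the trees
    of height less than h contribute at most t to z(1/B); hence Z_n <= t B^n.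
    Lower bound: grafting a tree on the leftmost leaf of another one makes
    Z_(n+1) / w_0 supermultiplicative in n, so by Fekete's argument it is enough
    to find, for each A < inf Phi(t)/t, one p > 0 with Z_(p+1) >= w_0 A^p. If
    there were none, z(1/y) would converge for every y > A, and z = z(1/y) would
    satisfy Phi(z)/z = y, which is impossible for A < y < inf Phi(t)/t.
    The infimum is attained at tau > 0: by Bernoulli's inequality,
    Phi(t) >= Phi(tau) (1 + Psi(tau) (t/tau - 1)) >= Phi(tau) t/tau, because
    Psi(tau) = 1, or else Psi(tau) < 1 and t <= tau = rho. *)

(* [tuple.v] also has a [tsize], which shadows the size of a tree. *)
Local Notation tsize := Defs.tsize.

(** * Unordered sums over sets of words *)

Lemma ge0_esumZl_EFin {R : realType} {T : choiceType} (A : set T) (c : R)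
    (f : T -> \bar R) : (0 <= c)%R -> (forall t, (0 <= f t)%E) ->
  (\esum_(t in A) (c%:E * f t) = c%:E * \esum_(t in A) f t)%E.
Proof.
move=> c_ge0 f_ge0; rewrite /esum -ereal_supZl//; last first.
  apply/set0P; exists 0%E; exists set0; [exact: fsets_set0|by rewrite fsbig_set0].
congr (ereal_sup _).
apply/seteqP; split => [_ [X [finX XA] <-]|_ [_ [X [finX XA] <-] <-]] /=.
- exists (\sum_(x \in X) f x)%E; first by exists X.
  by rewrite ge0_mule_fsumr.
- by exists X => //; rewrite ge0_mule_fsumr.
Qed.

Lemma esum_subset {R : realType} {T : choiceType} (A B : set T)
    (f : T -> \bar R) : A `<=` B -> (\esum_(t in A) f t <= \esum_(t in B) f t)%E.
Proof.
move=> AB; apply: ereal_sup_le => _ [X [finX XA] <-].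
by exists X => //; split => // x /XA/AB.
Qed.

Definition words {T : Type} (A : set T) (k : nat) : set (seq T) :=
  [set s | size s = k /\ List.Forall A s].

(** Splitting off the first letter identifies words of length k+1 with pairs of a letter and a word
    of length k, so each letter contributes one factor z. *)
Lemma esum_words {R : realType} {T : choiceType} (A : set T) (f : T -> R) (z : R)
    (k : nat) : (forall t, 0 <= f t) -> \esum_(t in A) (f t)%:E = z%:E ->
  \esum_(s in words A k) (foldr (fun t acc => f t * acc) 1 s)%:E = (z ^+ k)%:E.
Proof.
move=> f_ge0 fz.
have P_ge0 s : 0 <= foldr (fun t acc => f t * acc) 1 s.
  by elim: s => //= t s IH; rewrite mulr_ge0.
elim: k => [|k IH].
  rewrite (_ : words A 0 = [set [::]]) ?esum_set1//.
  by apply/seteqP; split => [[|t s] []|_ ->]//; split=> //; constructor.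
have z_ge0 : 0 <= z by rewrite -lee_fin -fz; apply: esum_ge0 => t _; rewrite lee_fin.
have -> : words A k.+1 = (fun p : T * seq T => p.1 :: p.2) @` (A `*` words A k).
  apply/seteqP; split => [[|t s] [//= [sk] As]|_ [[t s] [/= At [sk As]] <-]].
    by inversion As; exists (t, s).
  by split; [rewrite /= sk|constructor].
rewrite esum_image; last by move=> [t s] [t' s'] _ _ /= [-> ->].
rewrite -(@esum_esum _ _ _ A (fun=> words A k)
  (fun t s => (f t * foldr (fun t acc => f t * acc) 1 s)%:E)); last first.
  by move=> t s _ _; rewrite lee_fin mulr_ge0.
under eq_esum => t _.
  under eq_esum do rewrite EFinM.
  rewrite ge0_esumZl_EFin// IH muleC.
  over.
by rewrite ge0_esumZl_EFin ?exprn_ge0// fz -EFinM -exprSr.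
Qed.

(** * The generating function of trees, its functional equation and the upper bound *)

Section trees.
Context {R : realType} (w : nat -> R).
Hypothesis w_ge0 : forall k, 0 <= w k.

(** Children sit inside a list, so the inner fixpoint is what supplies the induction hypothesis for
    each of them. *)
Fixpoint otree_forall_rect (P : otree -> Prop)
    (PN : forall ts, List.Forall P ts -> P (Node ts)) (t : otree) : P t :=
  let: Node ts := t in
  PN ts ((fix F s : List.Forall P s := 
    if s is u :: s' then List.Forall_cons u (otree_forall_rect P PN u) (F s')
    else List.Forall_nil P) ts).

Lemma tweight_ge0 t : 0 <= tweight w t.
Proof.
elim/otree_forall_rect: t => ts IH /=; rewrite mulr_ge0//.
by elim: IH => //= t s t0 _ s0; rewrite mulr_ge0.
Qed.

(** The contribution of one tree to z(x) = sum_n Z_n x^n. *)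
Definition xweight (x : R) (t : otree) : R := tweight w t * x ^+ tsize t.

Lemma xweight_ge0 x t : 0 <= x -> 0 <= xweight x t.
Proof. by move=> x0; rewrite mulr_ge0 ?exprn_ge0// tweight_ge0. Qed.

Lemma xweight_Node x ts :
  xweight x (Node ts) = x * w (size ts) * foldr (fun t acc => xweight x t * acc) 1 ts.
Proof.
rewrite /xweight /= exprS.
suff -> : foldr (fun t acc => tweight w t * x ^+ tsize t * acc) 1 ts =
    foldr (fun s acc => tweight w s * acc) 1 ts * 
     x ^+ foldr (fun s acc => (tsize s + acc)%N) 0%N ts.
  by rewrite mulrACA; congr (_ * _); rewrite mulrC.
by elim: ts => /= [|t ts ->]; rewrite ?expr0 ?mulr1// exprD mulrACA.
Qed.

Definition nodes (A : set otree) : set otree :=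
  [set Node s | s in [set s | List.Forall A s]].

(** A root with k children contributes x w_k, and its children form a word over A, hence contribute
    z^k; summing over k gives x Phi(z). *)
Lemma esum_nodes (A : set otree) x z : 0 <= x ->
  \esum_(t in A) (xweight x t)%:E = z%:E ->
  \esum_(t in nodes A) (xweight x t)%:E = (x%:E * Phi w z)%E.
Proof.
move=> x0 Az.
have z0 : 0 <= z.
  by rewrite -lee_fin -Az; apply: esum_ge0 => t _; rewrite lee_fin xweight_ge0.
rewrite esum_image; last by move=> s s' _ _ [].
have -> : [set s | List.Forall A s] = \bigcup_k words A k.
  by apply/seteqP; split => [s As|s [k _ []]//]; exists (size s).
have P_ge0 s : 0 <= foldr (fun t acc => xweight x t * acc) 1 s.
  by elim: s => //= t s IH; rewrite mulr_ge0// xweight_ge0.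
rewrite nneseries_sum_bigcup; last 2 first.
- by move=> i j _ _ [s [[<- _] [<- _]]].
- by move=> s; rewrite lee_fin xweight_ge0.
rewrite /Phi -nneseriesZl; last by move=> k _; rewrite lee_fin mulr_ge0 ?exprn_ge0.
apply: eq_eseriesr => k _.
under eq_esum => s [sk _] do rewrite xweight_Node sk EFinM.
rewrite ge0_esumZl_EFin ?mulr_ge0//.
rewrite (esum_words A _ z)// => [|t]; last by rewrite xweight_ge0.
by rewrite -!EFinM mulrA.
Qed.

Lemma le_Phi s t : 0 <= s <= t -> (Phi w s <= Phi w t)%E.
Proof.
move=> /andP[s0 st]; apply: lee_nneseries => k _; rewrite lee_fin.
- by rewrite mulr_ge0 ?exprn_ge0.
- by rewrite ler_wpM2l// lerXn2r ?nnegrE// (le_trans s0).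
Qed.

Lemma tsize_node_lt t s : List.In t s -> (tsize t < tsize (Node s))%N.
Proof.
rewrite /= ltnS; elim: s => //= u s IH [->|/IH]; first exact: leq_addr.
by move=> /leq_trans; apply; exact: leq_addl.
Qed.

(* [iter h nodes set0] is the set of trees of height less than h. *)
Lemma tsize_iter_nodes h : [set t | (tsize t <= h)%N] `<=` iter h nodes set0.
Proof.
elim: h => [[s]//|h IH [s] /= sh]; exists s => //.
apply/List.Forall_forall => t /tsize_node_lt th; apply: IH => /=.
by rewrite -ltnS (leq_trans th).
Qed.

Lemma Zn_exprE n x : 0 <= x ->
  (Zn w n * (x ^+ n)%:E = \esum_(t in [set t | tsize t = n]) (xweight x t)%:E)%E.
Proof.
move=> x0; rewrite muleC -ge0_esumZl_EFin ?exprn_ge0//.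
  by apply: eq_esum => t /= <-; rewrite -EFinM mulrC.
by move=> t; rewrite lee_fin tweight_ge0.
Qed.

Lemma Phi_ge t : 0 <= t -> ((w 0%N)%:E <= Phi w t)%E.
Proof.
move=> t0; have /(@nneseries_lim_ge _ _ xpredT 0%N 1%N) :
    forall n, (0 <= n)%N -> xpredT n -> (0 <= (w n * t ^+ n)%:E)%E.
  by move=> k _ _; rewrite lee_fin mulr_ge0 ?exprn_ge0.
by rewrite big_nat1 expr0 mulr1.
Qed.

Lemma Zn_le t B n : 0 < t -> 0 < B -> Phi w t = (t * B)%:E ->
  (Zn w n <= (t * B ^+ n)%:E)%E.
Proof.
move=> t0 B0 PtB; set x := B^-1.
have x0 : 0 <= x by rewrite invr_ge0 ltW.
(* As x = 1/B, t is a fixed point of x Phi, and monotonicity of Phi keeps every iterate started at 0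
   below it. *)
have bound h : exists2 z, \esum_(u in iter h nodes set0) (xweight x u)%:E = z%:E &
    z <= t.
  elim: h => [|h [z hz zt]]; first by exists 0; rewrite ?esum_set0// ltW.
  have z0 : 0 <= z.
    by rewrite -lee_fin -hz; apply: esum_ge0 => u _; rewrite lee_fin xweight_ge0.
  have lePz : (Phi w z <= (t * B)%:E)%E by rewrite -PtB le_Phi// z0.
  have fPz : Phi w z \is a fin_num.
    by rewrite ge0_fin_numE ?(le_lt_trans lePz) ?ltry//
      (le_trans _ (Phi_ge _ z0))// lee_fin.
  exists (x * fine (Phi w z)); first by rewrite iterS (esum_nodes _ x z)// EFinM fineK.
  by rewrite ler_pdivrMl// mulrC -lee_fin fineK.
have [z hz zt] := bound n.
have : (Zn w n * (x ^+ n)%:E <= t%:E)%E.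
  rewrite Zn_exprE// (@le_trans _ _ z%:E) ?lee_fin//.
  rewrite -hz; apply: esum_subset => u /= un; apply: tsize_iter_nodes => /=.
  by rewrite un.
by rewrite /x exprVn lee_pdivrMr ?exprn_gt0// -EFinM.
Qed.

Lemma tweight_le_Zn t : ((tweight w t)%:E <= Zn w (tsize t))%E.
Proof.
rewrite -(@esum_set1 _ _ t (fun t => (tweight w t)%:E)) ?lee_fin ?tweight_ge0//.
by apply: esum_subset => _ ->.
Qed.

(** A single tree suffices: the star, a root with k leaves. *)
Lemma star_le_Zn k : ((w k * w 0 ^+ k)%:E <= Zn w k.+1)%E.
Proof.
have -> : w k * w 0 ^+ k = tweight w (Node (nseq k (Node [::]))).
  rewrite /= size_nseq; congr (_ * _).
  by elim: k => [|k /= <-]; rewrite ?expr0// exprS mulr1.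
have -> : k.+1 = tsize (Node (nseq k (Node [::]))).
  by rewrite /=; congr _.+1; elim: k => //= k <-.
exact: tweight_le_Zn.
Qed.

Lemma nodesT : nodes setT = setT.
Proof.
apply/seteqP; split=> // -[s] _; exists s => //=.
by apply/List.Forall_forall.
Qed.

(** Comparison with a geometric series makes z(1/y) converge. Its value solves Phi(z) = y z, because
    [nodes] maps the set of all trees onto itself. *)
Lemma Zn_functional c A y : 0 < w 0%N -> 0 <= c -> 0 <= A -> A < y ->
    (forall n, (Zn w n <= (c * A ^+ n)%:E)%E) ->
  exists2 z, 0 < z & Phi w z = (y * z)%:E.
Proof.
move=> w0 c0 A0 Ay ZA.
have y0 : 0 < y by exact: le_lt_trans Ay.
set x := y^-1; have x0 : 0 < x by rewrite invr_gt0.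
have x_ge0 := ltW x0.
pose Z := \esum_(u in setT) (xweight x u)%:E.
have Z0 : (0 <= Z)%E by apply: esum_ge0 => u _; rewrite lee_fin xweight_ge0 ?ltW.
have Zfin : (Z < +oo)%E.
  have -> : Z = (\sum_(0 <= n <oo) (Zn w n * (x ^+ n)%:E))%E.
    rewrite /Z (_ : setT = \bigcup_n [set t | tsize t = n]); last first.
      by apply/seteqP; split=> // t _; exists (tsize t).
    rewrite nneseries_sum_bigcup; last 2 first.
    - by move=> i j _ _ [s [/= <- <-]].
    - by move=> s; rewrite lee_fin xweight_ge0// ltW.
    by apply: eq_eseriesr => n _; rewrite Zn_exprE// ltW.
  apply: (@le_lt_trans _ _ (\sum_(0 <= n <oo) (c * (A * x) ^+ n)%:E)%E).
    apply: lee_nneseries => n _; first by rewrite Zn_exprE// esum_ge0// => u _;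
      rewrite lee_fin xweight_ge0.
    by rewrite exprMn mulrA EFinM lee_wpmul2r// lee_fin exprn_ge0// ltW.
  have q1 : `|A * x| < 1.
    by rewrite ger0_norm ?mulr_ge0// ?ltW// ltr_pdivrMr// mul1r.
  have /cvgP cvgq := cvg_geometric_series (a := c) q1.
  rewrite (_ : (fun n => _) = EFin \o series (geometric c (A * x))).
    by rewrite EFin_lim// ltry.
  by apply/funext => n; rewrite /series /= sumEFin.
have ZE : Z = (fine Z)%:E by rewrite fineK// ge0_fin_numE.
have hZ := esum_nodes setT _ _ (ltW x0) ZE.
(* The term n = 1 alone shows that the sum is positive. *)
have Zx : (Zn w 1 * (x ^+ 1)%:E <= Z)%E by rewrite Zn_exprE//; exact: esum_subset.
exists (fine Z).
  rewrite -lte_fin -ZE (lt_le_trans _ Zx)// mule_gt0//.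
  by apply: lt_le_trans (star_le_Zn 0); rewrite expr0 mulr1 lte_fin.
move: hZ; rewrite nodesT -/Z ZE /= EFinM => ->.
by rewrite muleA -EFinM divff ?gt_eqF// mul1e.
Qed.
End trees.

(** * Grafting of trees and supermultiplicativity *)

(** The factor is an extended real so that [Zn w b.+1] can be pulled out without first proving it
    finite. *)
Lemma ge0_esumZl {R : realType} {T : choiceType} (A : set T) (c : \bar R)
    (f : T -> \bar R) : (0 <= c)%E -> (forall t, (0 <= f t)%E) ->
  (\esum_(t in A) (c * f t) = c * \esum_(t in A) f t)%E.
Proof.
move=> + f_ge0; case: c => [c c_ge0|_|//]; first exact: ge0_esumZl_EFin.
have [f0|/existsNP[t /not_implyP[At /eqP ft0]]] := pselect (forall t, A t -> f t = 0%E).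
  by rewrite (esum1 f0) mule0 esum1// => t /f0->; rewrite mule0.
have ft : (0 < f t)%E by rewrite lt0e ft0 f_ge0.
have sub1 : [set t] `<=` A by move=> _ ->.
rewrite gt0_mulye; last first.
  apply: lt_le_trans ft _; rewrite -(@esum_set1 _ _ t f)//; exact: esum_subset.
apply/eqP; rewrite -leye_eq; apply: le_trans (esum_subset _ _ _ sub1).
by rewrite esum_set1 ?gt0_mulye// leey.
Qed.

(** Here [t] is the host, and [s] takes the place of the leaf that ends its leftmost branch. *)
Fixpoint graft (s t : otree) : otree :=
  match t with
  | Node [::] => s
  | Node (u :: us) => Node (graft s u :: us)
  end.

(** Induction along the leftmost branch, matching the recursion of [graft]. *)
Fixpoint otree_left_ind (P : otree -> Prop) (P0 : P (Node [::]))
    (PS : forall u us, P u -> P (Node (u :: us))) (t : otree) : P t :=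
  match t with
  | Node [::] => P0
  | Node (u :: us) => PS u us (otree_left_ind P P0 PS u)
  end.

Lemma tsize_gt0 t : (0 < tsize t)%N. Proof. by case: t. Qed.

Lemma tsize_graft s t : (tsize (graft s t)).+1 = (tsize s + tsize t)%N.
Proof.
elim/otree_left_ind: t => [|u us IH] /=; first by rewrite addn1.
by rewrite -addSn IH; lia.
Qed.

(** The hosts are compared along their leftmost branches. If one branch ended before the other, one
    grafted tree would equal a strictly larger one, against the equality of sizes. *)
Lemma graft_inj s t s' t' : tsize s = tsize s' ->
  graft s t = graft s' t' -> s = s' /\ t = t'.
Proof.
move=> ss'; elim/otree_left_ind: t t' => [|u us IH] [[|u' us']] //= E.
- have := tsize_graft s' (Node (u' :: us')).
  by rewrite /graft -/graft -E ss' /=; have := tsize_gt0 u'; lia.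
- have := tsize_graft s (Node (u :: us)).
  by rewrite /graft -/graft E ss' /=; have := tsize_gt0 u; lia.
- by case: E => /IH[-> ->] ->.
Qed.

Section graft_weight.
Context {R : realType} (w : nat -> R).
Hypothesis w_ge0 : forall k, 0 <= w k.

(** The factor w_0 accounts for the leaf that grafting removes. *)
Lemma tweight_graft s t :
  w 0 * tweight w (graft s t) = tweight w s * tweight w t.
Proof.
elim/otree_left_ind: t => [|u us IH] /=; first by rewrite mulr1 mulrC.
by rewrite (mulrCA (tweight w s)) (mulrA (tweight w s)) -IH; ring.
Qed.

(** For fixed sizes, grafting is an injection from pairs of trees into the trees with (a+1) + (b+1)
    - 1 nodes. *)
Lemma Zn_supermul a b :
  (Zn w a.+1 * Zn w b.+1 <= (w 0)%:E * Zn w (a + b).+1)%E.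
Proof.
have tw0 t : (0 <= (tweight w t)%:E)%E by rewrite lee_fin tweight_ge0.
have Zb0 : (0 <= Zn w b.+1)%E by exact: esum_ge0.
rewrite {1}/Zn muleC -ge0_esumZl//.
under eq_esum => s _ do rewrite muleC -ge0_esumZl_EFin ?tweight_ge0//.
rewrite (@esum_esum _ _ _ _ (fun=> [set t | tsize t = b.+1])
  (fun s t => (tweight w s)%:E * (tweight w t)%:E)%E); last first.
  by move=> s t _ _; rewrite mule_ge0.
rewrite -ge0_esumZl_EFin//.
under eq_esum => p _ do rewrite -EFinM -tweight_graft EFinM.
rewrite -(esum_image _ (fun p => graft p.1 p.2)
  (fun t => (w 0)%:E * (tweight w t)%:E)%E).
  apply: esum_subset => _ [[s t] [/= sa tb] <-] /=.
  by have := tsize_graft s t; rewrite sa tb; lia.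
move=> [s t] [s' t'] /set_mem[/= sa _] /set_mem[/= sa' _] E.
by have [-> ->] := graft_inj _ _ _ _ (etrans sa (esym sa')) E.
Qed.

Lemma Zn1 : Zn w 1 = (w 0)%:E.
Proof.
rewrite /Zn (_ : [set t | _] = [set Node [::]]).
  by rewrite esum_set1 /= mulr1 ?lee_fin.
apply/seteqP; split => [[[//|u us]] /= [] E|_ -> //].
by have := tsize_gt0 u; lia.
Qed.

Lemma Zn0 : Zn w 0 = 0%E.
Proof. by apply: esum1 => -[]. Qed.
Hypothesis w0_gt0 : 0 < w 0.

(* Here n counts edges rather than nodes, which makes Zn_ge multiplicative. *)
Definition Zn_ge (n : nat) (x : R) : Prop := ((w 0 * x)%:E <= Zn w n.+1)%E.

Lemma Zn_geM m n x y : 0 <= x -> 0 <= y ->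
  Zn_ge m x -> Zn_ge n y -> Zn_ge (m + n) (x * y).
Proof.
move=> x0 y0 mx ny; rewrite /Zn_ge -(@lee_pmul2l _ (w 0)%:E)//.
apply: le_trans (Zn_supermul m n).
have -> : ((w 0)%:E * (w 0 * (x * y))%:E = (w 0 * x)%:E * (w 0 * y)%:E)%E.
  by rewrite -!EFinM; congr _%:E; ring.
by apply: lee_pmul mx ny; rewrite lee_fin mulr_ge0.
Qed.

Lemma Zn_ge0n : Zn_ge 0 1.
Proof. by rewrite /Zn_ge Zn1 mulr1. Qed.

Lemma Zn_geX q n x : 0 <= x -> Zn_ge n x -> Zn_ge (q * n) (x ^+ q).
Proof.
move=> x0 nx; elim: q => [|q IH]; first by rewrite mul0n expr0; exact: Zn_ge0n.
by rewrite mulSn exprS; apply: Zn_geM => //; rewrite exprn_ge0.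
Qed.

(** Amounts to Z_(n+1) > 0; these n form an additive semigroup containing 0. *)
Definition Zn_pos (n : nat) : Prop := exists2 x, 0 < x & Zn_ge n x.

Lemma Zn_pos_star k : 0 < w k -> Zn_pos k.
Proof.
move=> wk; exists (w k * w 0 ^+ k / w 0); first by rewrite divr_gt0 ?mulr_gt0 ?exprn_gt0.
by rewrite /Zn_ge mulrC divfK ?gt_eqF//; exact: star_le_Zn.
Qed.

Lemma Zn_posD m n : Zn_pos m -> Zn_pos n -> Zn_pos (m + n).
Proof.
by move=> [x x0 mx] [y y0 ny]; exists (x * y);
  [exact: mulr_gt0|apply: Zn_geM => //; exact: ltW].
Qed.

End graft_weight.

(** * Numerical semigroups and two elementary inequalities *)

(** Take for g the least positive difference of two elements s and s + g of S; combinations of s and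
    s + g then reach every large multiple of g. *)
Lemma numerical_semigroup (S : nat -> Prop) k : S 0%N ->
    (forall m n, S m -> S n -> S (m + n)%N) -> (0 < k)%N -> S k ->
  exists2 g, (0 < g)%N /\ (forall s, S s -> (g %| s)%N) &
    exists N, forall m, (N <= m)%N -> S (g * m)%N.
Proof.
move=> S0 SD k0 Sk.
have SM q s : S s -> S (q * s)%N.
  by move=> Ss; elim: q => [//|q IH]; rewrite mulSn; exact: SD.
pose D g := `[< (0 < g)%N /\ exists s, S s /\ S (s + g)%N >].
have exD : exists g, D g by exists k; apply/asboolP; split=> //; exists 0%N.
case: (ex_minnP exD) => g /asboolP[g0 [s [Ss Ssg]]] gmin.
have gdvd u : S u -> (g %| u)%N.
  move=> Su; rewrite /dvdn; apply/contraT => r0.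
  have : D (u %% g)%N.
    apply/asboolP; split; first by rewrite lt0n.
    (* The remainder of u is again a difference of two elements of S, namely (u/g)(s+g) and (u/g)s +
       u; this contradicts the minimality of g. *)
    exists (u %/ g * (s + g))%N; split; first exact: SM.
    have -> : (u %/ g * (s + g) + u %% g = u %/ g * s + u)%N.
      by rewrite mulnDr -addnA -divn_eq.
    by apply: SD => //; exact: SM.
  by move=> /gmin; rewrite leqNgt ltn_pmod.
exists g; first by split.
have /dvdnP[e se] := gdvd _ Ss.
(* Since s = e g, the bound m >= e^2 makes the quotient of m by e exceed its remainder, so the
   coefficient of s below is not truncated. *)
exists (e * e)%N => m em.
have [e0|e_gt0] := posnP e.
  by rewrite mulnC; apply: SM; move: Ssg; rewrite se e0.
have -> : (g * m = (m %/ e - m %% e) * s + m %% e * (s + g))%N.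
  have re : (m %% e <= m %/ e)%N.
    by rewrite (@leq_trans e) ?leq_divRL// ltnW// ltn_pmod.
  by rewrite mulnDr addnA -mulnDl subnK// {1}(divn_eq m e) se; ring.
by apply: SD; exact: SM.
Qed.

Lemma uniform_pos_bound {R : realDomainType} (P : nat -> R -> Prop) p :
    (forall r, exists2 x, 0 < x & forall y, y <= x -> P r y) ->
  exists2 c, 0 < c & forall r, (r < p)%N -> P r c.
Proof.
(* Asking for all y <= c lets the induction pass to the minimum of two bounds. *)
move=> hP; suff [c c0 hc] : exists2 c, 0 < c &
    forall r, (r < p)%N -> forall y, y <= c -> P r y.
  by exists c => // r rp; exact: hc.
elim: p => [|p [c c0 IH]]; first by exists 1.
have [x x0 hx] := hP p.
exists (Num.min c x) => [|r]; first by rewrite lt_min c0.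
rewrite ltnS leq_eqVlt => /predU1P[->|rp] y; rewrite le_min => /andP[yc yx].
- exact: hx.
- exact: IH.
Qed.

Lemma bernoulli_inequality {R : realDomainType} n (x : R) : 0 <= x ->
  1 + n%:R * (x - 1) <= x ^+ n.
Proof.
move=> x0; elim: n => [|n IH]; first by rewrite mul0r addr0 expr0.
have := ler_wpM2l x0 IH; rewrite exprS; apply: le_trans.
(* The induction step gains exactly n (x - 1)^2. *)
have := mulr_ge0 (ler0n R n) (sqr_ge0 (x - 1)); rewrite -natr1; nra.
Qed.

(** * Exponential lower bounds along n = d m + 1 *)

Section growth.
Context {R : realType} (w : nat -> R).
Hypothesis w_ge0 : forall k, 0 <= w k.
Hypothesis w0_gt0 : 0 < w 0.

(** The least common multiple of d and g still divides every k with w_k > 0, so maximality of d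
    forces it to be d. *)
Lemma dvdn_span d g : is_span w d -> (0 < g)%N ->
  (forall k, 0 < w k -> (g %| k)%N) -> (g %| d)%N.
Proof.
move=> [d0 [dw dmax]] g0 gw.
have : (lcmn d g <= d)%N.
  by apply: dmax => [|k wk]; rewrite ?lcmn_gt0 ?d0// dvdn_lcm dw// gw.
move=> led; have <- : lcmn d g = d.
  by apply/eqP; rewrite eqn_leq led dvdn_leq ?lcmn_gt0 ?d0// dvdn_lcml.
exact: dvdn_lcmr.
Qed.

(** By stars, the semigroup of [Zn_pos] contains every k with w_k > 0. Its modulus g divides all
    these k, hence d, so large multiples of d belong to it. *)
Lemma Zn_pos_span d k : is_span w d -> (0 < k)%N -> 0 < w k ->
  exists N, forall m, (N <= m)%N -> Zn_pos w (d * m).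
Proof.
move=> dspan k0 wk.
have S0 : Zn_pos w 0 by exists 1 => //; exact: Zn_ge0n.
have SD := Zn_posD w w_ge0 w0_gt0.
have [g [g0 gdvd] [N HN]] := numerical_semigroup (Zn_pos w) k S0 SD k0
  (Zn_pos_star w w_ge0 w0_gt0 _ wk).
have /dvdnP[e de] : (g %| d)%N.
  by apply: dvdn_span => // j wj; apply: gdvd; exact: Zn_pos_star.
have d0 : (0 < d)%N by case: dspan.
exists N => m Nm; rewrite de (mulnC e) -mulnA; apply: HN.
rewrite (leq_trans Nm)// leq_pmull//; move: d0.
by rewrite de muln_gt0 => /andP[].
Qed.

Lemma Zn_ge_le n x y : x <= y -> Zn_ge w n y -> Zn_ge w n x.
Proof. by move=> xy; apply: le_trans; rewrite lee_fin ler_pM2l. Qed.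

(* Fekete's argument: write m = q p + (N + r) with r < p. *)
Lemma Zn_ge_fekete d k A p : is_span w d -> (0 < k)%N -> 0 < w k ->
    0 < A -> (0 < p)%N -> Zn_ge w p (A ^+ p) ->
  exists2 c, 0 < c & exists N, forall m, (N <= m)%N ->
    Zn_ge w (d * m) (c * A ^+ (d * m)).
Proof.
move=> dspan k0 wk A0 p0 pA.
have [N HN] := Zn_pos_span _ _ dspan k0 wk.
have An0 n : 0 < A ^+ n by rewrite exprn_gt0.
have [c c0 hc] : exists2 c, 0 < c & forall r, (r < p)%N ->
    Zn_ge w (d * (N + r)) (c * A ^+ (d * (N + r))).
  apply: (@uniform_pos_bound _
    (fun r c => Zn_ge w (d * (N + r)) (c * A ^+ (d * (N + r))))) => r.
  have [x x0 hx] := HN _ (leq_addr r N).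
  exists (x / A ^+ (d * (N + r))); first by rewrite divr_gt0.
  by move=> y yx; apply: Zn_ge_le hx; rewrite -ler_pdivlMr.
exists c => //; exists N => m Nm.
have -> : (d * m = (d * ((m - N) %/ p)) * p + d * (N + (m - N) %% p))%N.
  rewrite -mulnA -mulnDr; congr (_ * _)%N.
  by rewrite addnCA -divn_eq subnKC.
rewrite exprD mulrCA (mulnC _ p) exprM.
rewrite (mulnC p).
apply: Zn_geM => //.
- by rewrite exprn_ge0// ltW.
- by rewrite mulr_ge0 ?ltW.
- by apply: Zn_geX => //; exact: ltW.
- by apply: hc; rewrite ltn_pmod.
Qed.

Lemma Zn_lower d k A y : is_span w d -> (0 < k)%N -> 0 < w k ->
    0 < A -> A < y -> (forall z, 0 < z -> ((y * z)%:E < Phi w z)%E) ->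
  exists2 c, 0 < c & exists N, forall m, (N <= m)%N ->
    ((c * A ^+ (d * m).+1)%:E <= Zn w (d * m).+1)%E.
Proof.
move=> dspan k0 wk A0 Ay hy.
have [[p p0 pA]|noA] := pselect (exists2 p, (0 < p)%N & Zn_ge w p (A ^+ p)).
  have [c c0 [N hN]] := Zn_ge_fekete _ _ _ _ dspan k0 wk A0 p0 pA.
  (* The factors w_0 and 1/A translate from d m edges to d m + 1 nodes. *)
  exists (w 0 * c / A); first by rewrite divr_gt0// mulr_gt0.
  exists N => m /hN; rewrite /Zn_ge.
  by rewrite exprS !mulrA divfK ?gt_eqF.
(* If no p works, all Z_n obey one geometric bound, which yields a solution of Phi(z) = y z and
   contradicts [hy]. *)
have ZA n : (Zn w n <= (w 0 / A * A ^+ n)%:E)%E.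
  case: n => [|[|n]].
  - by rewrite Zn0 lee_fin mulr_ge0// ?divr_ge0 ?exprn_ge0// ltW.
  - by rewrite Zn1// expr1 divfK ?gt_eqF.
  - rewrite exprS mulrA divfK ?gt_eqF// ltW// ltNge.
    by apply/negP => ge; apply: noA; exists n.+1.
have [z z0 Pz] := Zn_functional w w_ge0 _ _ _ w0_gt0
  (ltW (divr_gt0 w0_gt0 A0)) (ltW A0) Ay ZA.
by have := hy _ z0; rewrite Pz ltxx.
Qed.

(** * Analysis of Phi and Psi up to the radius of convergence *)

Lemma Phi0 : Phi w 0 = (w 0)%:E.
Proof.
apply/eqP; rewrite eq_le Phi_ge// andbT.
rewrite /Phi nneseries_recl//; last first.
  by move=> k _; rewrite lee_fin mulr_ge0 ?exprn_ge0.
rewrite expr0 mulr1 [X in (_ + X)%E]eseries0 ?adde0// => k k0 _.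
by rewrite expr0n gtn_eqF// mulr0.
Qed.

Lemma tPhi'0 : tPhi' w 0 = 0%E.
Proof.
apply: eseries0 => -[|k] _ _; first by rewrite !mul0r.
by rewrite expr0n mulr0.
Qed.

(* Bernoulli's inequality applied to each monomial. *)
Lemma Phi_tangent tau t p q : 0 < tau -> 0 <= t ->
    Phi w tau = p%:E -> tPhi' w tau = q%:E -> 0 <= (q - p) * (t - tau) ->
  ((p / tau * t)%:E <= Phi w t)%E.
Proof.
move=> tau0 t0 Pp Tq pq; set s := t / tau.
have s0 : 0 <= s by rewrite divr_ge0// ltW.
have term_ge0 k x : 0 <= x -> (0 <= (w k * x ^+ k)%:E)%E.
  by move=> x0; rewrite lee_fin mulr_ge0 ?exprn_ge0.
have term'_ge0 k x : 0 <= x -> (0 <= (k%:R * w k * x ^+ k)%:E)%E.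
  by move=> x0; rewrite lee_fin !mulr_ge0 ?exprn_ge0.
have tau_ge0 := ltW tau0.
(* The negative part of each Bernoulli term is moved to the right, so that only series of
   nonnegative terms are added. *)
have H : (Phi w tau + s%:E * tPhi' w tau <= Phi w t + tPhi' w tau)%E.
  rewrite /Phi /tPhi' -nneseriesZl//; last by move=> k _; exact: term'_ge0.
  rewrite -!nneseriesD//.
  - apply: lee_nneseries => k _.
      move=> _; apply: adde_ge0; first exact: term_ge0.
      by apply: mule_ge0; [rewrite lee_fin|exact: term'_ge0].
    rewrite -EFinM -!EFinD lee_fin.
    have -> : t ^+ k = s ^+ k * tau ^+ k by rewrite -exprMn divfK ?gt_eqF.
    have := bernoulli_inequality k _ s0.
    have := mulr_ge0 (w_ge0 k) (exprn_ge0 k tau_ge0).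
    move: (tau ^+ k) (s ^+ k) (w k) => T S wk' TS h; nra.
  - by move=> k *; exact: term_ge0.
  - by move=> k *; exact: term'_ge0.
  - by move=> k *; exact: term_ge0.
  - by move=> k *; apply: mule_ge0; [rewrite lee_fin|exact: term'_ge0].
move: H; rewrite Pp Tq -EFinM -EFinD.
case: (Phi w t) => [v|_|//]; last by rewrite leey.
rewrite -EFinD !lee_fin => H.
have : 0 <= (q - p) * (s - 1).
  have -> : s - 1 = (t - tau) / tau by rewrite mulrBl divff ?gt_eqF.
  by rewrite mulrA divr_ge0.
have -> : p / tau * t = p * s by rewrite mulrAC mulrA.
by move: H; lra.
Qed.

Lemma Phi_gt0 t : 0 <= t -> (0 < Phi w t)%E.
Proof. by move=> t0; apply: lt_le_trans (Phi_ge _ w_ge0 _ t0); rewrite lte_fin. Qed.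

Lemma Phi_lt_rho t : 0 <= t -> (t%:E < rho w)%E -> (Phi w t < +oo)%E.
Proof.
move=> t0 /ereal_sup_gt[_ [u [u0 Pu] <-]]; rewrite lte_fin => tu.
by apply: le_lt_trans Pu; apply: le_Phi => //; rewrite t0 ltW.
Qed.

Lemma le_rho t : 0 <= t -> (Phi w t < +oo)%E -> (t%:E <= rho w)%E.
Proof. by move=> t0 Pt; apply: ereal_sup_ubound; exists t. Qed.

Lemma rho_ge0 : (0 <= rho w)%E.
Proof. by apply: le_rho => //; rewrite Phi0 ltry. Qed.

(** Some partial sum already exceeds Q at r; being a polynomial, it still does just to the left of
    r. *)
Lemma Phi_near_left r Q : 0 < r -> Phi w r = +oo%E ->
  \forall t \near r^'-, (Q%:E <= Phi w t)%E.
Proof.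
move=> r0 Pr.
have term_ge0 x : 0 <= x -> forall k, (0 <= k)%N -> xpredT k -> (0 <= (w k * x ^+ k)%:E)%E.
  by move=> x0 k _ _; rewrite lee_fin mulr_ge0 ?exprn_ge0.
have [n Qn] : exists n, Q < (\poly_(k < n) w k).[r].
  apply/not_existsP => hQ; suff : (Phi w r <= Q%:E)%E by rewrite Pr.
  apply: lime_le; first by apply: is_cvg_nneseries => k _ _; rewrite term_ge0// ltW.
  apply: nearW => n; rewrite sumEFin lee_fin leNgt; apply/negP => Qn.
  by apply: (hQ n); rewrite horner_poly -(big_mkord xpredT (fun k => w k * r ^+ k)).
have near_Q : \forall t \near r^'-, Q < (\poly_(k < n) w k).[t].
  by apply: cvgr_gt Qn; apply: cvg_at_left_filter; exact: continuous_horner.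
near=> t.
have t0 : 0 < t by near: t; exact: nbhs_left_gt.
apply: le_trans (nneseries_lim_ge n (term_ge0 _ (ltW t0))).
rewrite sumEFin lee_fin ltW//.
rewrite big_mkord -(horner_poly n w).
by near: t.
Unshelve. all: by end_near.
Qed.

(** Terms with k >= K satisfy K w_k t^k <= k w_k t^k; the finitely many others are bounded at r, so
    the error is independent of t. *)
Lemma tPhi'_truncation t r K : 0 <= t <= r ->
  (K%:R%:E * Phi w t <= tPhi' w t + (\sum_(0 <= k < K) K%:R * w k * r ^+ k)%:E)%E.
Proof.
move=> /andP[t0 tr].
have g0 k : (0 <= (if (k < K)%N then (K%:R * w k * r ^+ k)%:E else 0))%E.
  by case: ifP => // _; rewrite lee_fin !mulr_ge0 ?exprn_ge0// (le_trans t0).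
have -> : ((\sum_(0 <= k < K) K%:R * w k * r ^+ k)%:E =
    \sum_(0 <= k <oo) if (k < K)%N then (K%:R * w k * r ^+ k)%:E else 0)%E.
  rewrite (nneseries_split 0 K)// [X in (_ + X)%E]eseries0 ?adde0.
    rewrite -sumEFin add0n; apply: eq_big_nat => k /andP[_ ->] //.
  by move=> k; rewrite add0n => Kk _; rewrite ltnNge Kk.
rewrite /Phi /tPhi' -nneseriesZl -?nneseriesD//.
- apply: lee_nneseries => k _.
    by rewrite mule_ge0 ?lee_fin ?mulr_ge0 ?exprn_ge0.
  have wt0 := mulr_ge0 (w_ge0 k) (exprn_ge0 k t0).
  case: ltnP => kK; rewrite ?adde0 -?EFinM -?EFinD lee_fin !mulrA.
    rewrite ler_wpDl ?mulr_ge0 ?exprn_ge0// ler_wpM2l ?mulr_ge0//.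
    by rewrite lerXn2r ?nnegrE// (le_trans t0).
  by rewrite -!mulrA ler_wpM2r// ler_nat.
- by move=> k _; rewrite lee_fin !mulr_ge0 ?exprn_ge0.
- by move=> k _; rewrite lee_fin !mulr_ge0 ?exprn_ge0.
Qed.

(** Truncation gives Psi(t) >= K - Q / Phi(t), and Phi(t) >= Q near r. Hence Psi(t) >= K - 1 >= M
    there. *)
Lemma nu_divergent r : 0 < r -> rho w = r%:E -> Phi w r = +oo%E -> nu w = +oo%E.
Proof.
move=> r0 rr Pr; rewrite /nu rr Pr ltxx; apply/cvg_lim => //.
apply/cvgeyPge => M.
have [K MK] : exists K : nat, M + 1 <= K%:R.
  exists (Num.truncn (M + 1)).+1; exact/ltW/truncnS_gt.
pose Q := \sum_(0 <= k < K) K%:R * w k * r ^+ k.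
near=> t.
have t0 : 0 < t by near: t; exact: nbhs_left_gt.
have tr : t < r by near: t; exact: nbhs_left_lt.
have QP : (Q%:E <= Phi w t)%E by near: t; exact: Phi_near_left.
have := @tPhi'_truncation t r K; rewrite -/Q (ltW t0) (ltW tr) => /(_ isT).
have Pt : (Phi w t < +oo)%E by apply: Phi_lt_rho; rewrite ?rr ?ltW ?lte_fin.
rewrite /Psi; have := Phi_gt0 _ (ltW t0).
case: (Phi w t) Pt QP => [p| |]// _; rewrite lee_fin lte_fin => Qp p0.
rewrite inver gt_eqF// lee_pdivlMr//.
case: (tPhi' w t) => [q| |]//; last by move=> _; exact: leey.
rewrite -!EFinM -EFinD !lee_fin; nra.
Unshelve. all: by end_near.
Qed.

End growth.

(** * From geometric bounds to limits of logarithmic rates *)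

Section rates.
Context {R : realType}.
Implicit Types (A B c t e K : R) (Z : \bar R).

Lemma lne_geometric c A n : 0 < c -> 0 < A -> (0 < n)%N ->
  (lne (c * A ^+ n)%:E * (n%:R^-1)%:E = (ln c / n%:R + ln A)%:E)%E.
Proof.
move=> c0 A0 n0; have An0 : 0 < A ^+ n by rewrite exprn_gt0.
rewrite lne_EFin ?mulr_gt0// -EFinM lnM ?posrE// lnXn// mulrDl.
by rewrite -(mulr_natr (ln A)) mulfK// pnatr_eq0 -lt0n.
Qed.

Lemma lne_rate_ge c A n Z : 0 < c -> 0 < A -> (0 < n)%N ->
  ((c * A ^+ n)%:E <= Z)%E ->
  ((ln c / n%:R + ln A)%:E <= lne Z * (n%:R^-1)%:E)%E.
Proof.
move=> c0 A0 n0 cZ; rewrite -lne_geometric//.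
have An0 : 0 <= c * A ^+ n by rewrite mulr_ge0 ?exprn_ge0// ltW.
apply: lee_wpmul2r; first by rewrite lee_fin invr_ge0.
rewrite lee_lne// in_itv/= leey andbT ?lee_fin//.
by apply: le_trans cZ; rewrite lee_fin.
Qed.

Lemma lne_rate_le c A n Z : 0 < c -> 0 < A -> (0 < n)%N ->
  (0 <= Z)%E -> (Z <= (c * A ^+ n)%:E)%E ->
  (lne Z * (n%:R^-1)%:E <= (ln c / n%:R + ln A)%:E)%E.
Proof.
move=> c0 A0 n0 Z0 cZ; rewrite -lne_geometric//.
have An0 : 0 <= c * A ^+ n by rewrite mulr_ge0 ?exprn_ge0// ltW.
apply: lee_wpmul2r; first by rewrite lee_fin invr_ge0.
by rewrite lee_lne// in_itv/= leey andbT ?lee_fin.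
Qed.

Lemma near_norm_div_le K e d : 0 < e -> (0 < d)%N ->
  \forall m \near \oo, `|K / (d * m).+1%:R| <= e.
Proof.
move=> e0 d0; near=> m.
rewrite normf_div [`|_.+1%:R|]ger0_norm// ler_pdivrMr//.
have : `|K| / e <= m%:R by near: m; exact: nbhs_infty_ger.
rewrite ler_pdivrMr// mulrC => /le_trans; apply.
by rewrite ler_pM2l// ler_nat ltnW// ltnS leq_pmull.
Unshelve. all: by end_near.
Qed.

(** The constant c disappears in the rate, where it contributes only (ln c)/n. *)
Definition eventually_ge (Z : nat -> \bar R) (d : nat) A : Prop :=
  exists2 c : R, 0 < c & exists N, forall m, (N <= m)%N ->
    ((c * A ^+ (d * m).+1)%:E <= Z (d * m).+1)%E.

Lemma eventually_ge_rate (Z : nat -> \bar R) d A e : (0 < d)%N -> 0 < A ->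
    0 < e -> eventually_ge Z d A ->
  \forall m \near \oo,
    ((ln A - e)%:E <= lne (Z (d * m).+1) * ((d * m).+1%:R^-1)%:E)%E.
Proof.
move=> d0 A0 e0 [c c0 [N hN]]; near=> m.
have Nm : (N <= m)%N by near: m; exact: nbhs_infty_ge.
apply: le_trans (lne_rate_ge _ _ _ _ c0 A0 _ (hN _ Nm)) => //.
have : `|ln c / (d * m).+1%:R| <= e by near: m; exact: near_norm_div_le.
by rewrite lee_fin ler_norml; move: (ln c / _) => x /andP[]; lra.
Unshelve. all: by end_near.
Qed.

Lemma cvg_lne_rate_y (Z : nat -> \bar R) d : (0 < d)%N ->
    (forall A, 0 < A -> eventually_ge Z d A) ->
  (lne (Z (d * m).+1) * ((d * m).+1%:R^-1)%:E)%E @[m --> \oo] --> +oo%E.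
Proof.
move=> d0 hZ; apply/cvgeyPge => M.
(* Base e^(M+1) has rate M + 1, which leaves room for an error of 1. *)
have eM0 : 0 < expR (M + 1) :> R by exact: expR_gt0.
have := eventually_ge_rate _ _ _ 1 d0 eM0 ltr01 (hZ _ eM0).
by rewrite expRK addrK.
Qed.

Lemma cvg_lne_rate (Z : nat -> \bar R) d t B : (0 < d)%N -> 0 < t -> 0 < B ->
    (forall n, (0 <= Z n)%E) -> (forall n, (Z n <= (t * B ^+ n)%:E)%E) ->
    (forall A, 0 < A -> A < B -> eventually_ge Z d A) ->
  (lne (Z (d * m).+1) * ((d * m).+1%:R^-1)%:E)%E @[m --> \oo] --> (ln B)%:E.
Proof.
move=> d0 t0 B0 Z0 Zle Zge.
pose u m := (lne (Z (d * m).+1) * ((d * m).+1%:R^-1)%:E)%E.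
suff : u @ \oo --> (ln B)%:E by [].
have bound e : 0 < e ->
    \forall m \near \oo, ((ln B - e)%:E <= u m <= (ln B + e)%:E)%E.
  (* Half of the error e is spent on replacing B by A, the other half on the constant of the lower
     bound. *)
  move=> e0; pose A := B * expR (- (e / 2)).
  have A0 : 0 < A by rewrite mulr_gt0 ?expR_gt0.
  have AB : A < B by rewrite gtr_pMr// expR_lt1; lra.
  have lnA : ln A = ln B - e / 2 by rewrite lnM ?posrE ?expR_gt0// expRK.
  have e20 : 0 < e / 2 by lra.
  near=> m; apply/andP; split.
    have -> : ln B - e = ln A - e / 2 by rewrite lnA; lra.
    by near: m; apply: eventually_ge_rate => //; exact: Zge.
  apply: le_trans (lne_rate_le _ _ _ _ t0 B0 _ (Z0 _) (Zle _)) _ => //.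
  have : `|ln t / (d * m).+1%:R| <= e by near: m; exact: near_norm_div_le.
  by rewrite lee_fin ler_norml; move: (ln t / _) => x /andP[]; lra.
have fin_u (a b : R) (x : \bar R) : (a%:E <= x <= b%:E)%E -> x \is a fin_num.
  move=> /andP[h1 h2].
  by rewrite fin_numElt (lt_le_trans (ltNyr _) h1) (le_lt_trans h2 (ltry _)).
apply/fine_cvgP; split.
  by apply: filterS (bound 1 ltr01) => m; exact: fin_u.
apply/cvgrPdist_le => e e0; apply: filterS (bound e e0) => m ub.
have /fineK um := fin_u _ _ _ ub.
by move: ub; rewrite -um !lee_fin distrC ler_distl.
Unshelve. all: by end_near.
Qed.

End rates.

(** * The minimum of Phi(t)/t at tau *)

Section tau.
Context {R : realType} (w : nat -> R) (tau : R).
Hypothesis w_ge0 : forall k, 0 <= w k.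
Hypothesis w0_gt0 : 0 < w 0.
Hypothesis htau1 : (1 <= nu w)%E ->
  0 <= tau /\ (tau%:E <= rho w)%E /\ (Phi w tau < +oo)%E /\ Psi w tau = 1%E.
Hypothesis htau2 : (nu w < 1)%E -> tau%:E = rho w.

(** Since Phi(t) is positive and finite, an infinite t Phi'(t) would make Psi(t) infinite. *)
Lemma Psi_fin t p : 0 <= t -> Phi w t = p%:E -> (Psi w t <= 1)%E ->
  0 < p /\ exists2 q, tPhi' w t = q%:E & Psi w t = (q / p)%:E.
Proof.
move=> t0 Pp; have := Phi_gt0 w w_ge0 w0_gt0 _ t0.
rewrite Pp lte_fin => p0; rewrite /Psi Pp inver gt_eqF//.
have : (0 <= tPhi' w t)%E.
  by apply: nneseries_ge0 => k _ _; rewrite lee_fin !mulr_ge0 ?exprn_ge0.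
case: (tPhi' w t) => [q _ _| _|//]; first by split=> //; exists q.
by rewrite gt0_mulye ?lte_fin ?invr_gt0.
Qed.

(** Outside the degenerate case, B = Phi(tau)/tau; [key] reduces its minimality to a sign condition
    for the tangent bound. *)
Lemma tau_cases : (tau = 0 /\ rho w = 0%E) \/
  exists B, [/\ 0 < tau, 0 < B, Phi w tau = (tau * B)%:E &
    forall t, 0 <= t -> ((B * t)%:E <= Phi w t)%E].
Proof.
have key p q : 0 < tau -> 0 < p -> Phi w tau = p%:E -> tPhi' w tau = q%:E ->
    (forall t, 0 <= t -> (Phi w t < +oo)%E -> 0 <= (q - p) * (t - tau)) ->
    exists B, [/\ 0 < tau, 0 < B, Phi w tau = (tau * B)%:E &
      forall t, 0 <= t -> ((B * t)%:E <= Phi w t)%E].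
  move=> tau0 p0 Pp Tq pq; exists (p / tau); split => //.
  - by rewrite divr_gt0.
  - by rewrite mulrC divfK ?gt_eqF.
  - move=> t t0; have [Pt|] := ltP (Phi w t) +oo%E; last first.
      by rewrite leye_eq => /eqP ->; rewrite leey.
    by apply: (Phi_tangent _ _ _ _ _ q) => //; exact: pq.
have [nu1|/htau1[tau0 [_ [Pt Psi1]]]] := ltP (nu w) 1%E; last first.
  right.
  have [p Pp] : exists p, Phi w tau = p%:E.
    by exists (fine (Phi w tau)); rewrite fineK// ge0_fin_numE// ltW// Phi_gt0.
  have [|p0 [q Tq]] := Psi_fin _ _ tau0 Pp; first by rewrite Psi1.
  (* Psi(tau) = 1 means q = p, so the sign condition is trivial; tau = 0 would give q = 0 < p. *)
  rewrite Psi1 => -[/esym/divr1_eq qp].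
  apply: (key p q) => //; last by move=> t _ _; rewrite qp subrr mul0r.
  rewrite lt_neqAle tau0 andbT; apply/eqP => tau_0; move: Tq.
  by rewrite -tau_0 tPhi'0 => -[q0]; move: p0; rewrite -qp -q0 ltxx.
have tr := htau2 nu1.
have tau0 : 0 <= tau by rewrite -lee_fin tr rho_ge0.
move: tau0; rewrite le_eqVlt => /predU1P[tau_0|tau0].
  by left; split; [|rewrite -tr -tau_0].
right.
have tau_ge0 := ltW tau0.
(* If Phi diverged at tau = rho, then nu would be +oo rather than below 1. *)
have Pfin : (Phi w tau < +oo)%E.
  rewrite ltey; apply/eqP => Poo; move: nu1.
  by rewrite (nu_divergent _ w_ge0 w0_gt0 tau).
have [p Pp] : exists p, Phi w tau = p%:E.
  by exists (fine (Phi w tau)); rewrite fineK// ge0_fin_numE// ltW// Phi_gt0.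
have nuE : nu w = Psi w tau by rewrite /nu -tr Pfin.
have Psi1 : (Psi w tau < 1)%E by rewrite -nuE.
have [p0 [q Tq Psiq]] := Psi_fin _ _ tau_ge0 Pp (ltW Psi1).
apply: (key p q) => // t t0 Pt.
move: Psi1; rewrite Psiq lte_fin ltr_pdivrMr// mul1r => qp.
have := le_rho w _ t0 Pt; rewrite -tr lee_fin => ttau.
by rewrite mulr_le0// subr_le0// ltW.
Qed.

End tau.

(** * The limit of the rate, in the cases rho = 0 and rho > 0 *)

Theorem theorem17p6 (R : realType) (w : nat -> R) (d : nat) (tau : R)
  (w_ge0 : forall k, 0 <= w k)
  (w0_gt0 : 0 < w 0%N)
  (wk_gt0 : exists2 k, (2 <= k)%N & 0 < w k)
  (hd : is_span w d)
  (htau1 : (1 <= nu w)%E ->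
     0 <= tau /\ (tau%:E <= rho w)%E /\ (Phi w tau < +oo)%E /\ Psi w tau = 1%E)
  (htau2 : (nu w < 1)%E -> tau%:E = rho w) :
  let L := (lne (Phi w tau) - lne tau%:E)%E in
  ((fun m : nat => (lne (Zn w (d * m).+1) * ((d * m).+1%:R^-1)%:E)%E) @ \oo --> L)
  /\ L = lne (ereal_inf [set (Phi w t / t%:E)%E | t in [set t : R | 0 <= t]])
  /\ ((0 < rho w)%E -> L \is a fin_num)
  /\ (rho w = 0%E -> L = +oo%E).
Proof.
move=> L.
have d0 : (0 < d)%N by case: hd.
have [k k2 wk] := wk_gt0; have k0 := ltnW k2.
have lower A y := Zn_lower w w_ge0 w0_gt0 d k A y hd k0 wk.
(* The inverse of 0 is +oo here, so t = 0 does not affect the infimum. *)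
have div0 : (Phi w 0 / 0 = +oo)%E by rewrite inve0 gt0_muley// Phi_gt0.
have [[tau_0 rho_0]|[B [tau0 B0 PB hB]]] := tau_cases w tau w_ge0 w0_gt0 htau1 htau2.
  have Poo t : 0 < t -> Phi w t = +oo%E.
    move=> t0; apply/eqP; rewrite -leye_eq leNgt; apply/negP => Pt.
    by have := le_rho w _ (ltW t0) Pt; rewrite rho_0 lee_fin leNgt t0.
  (* The logarithm of tau = 0 is -oo, while Phi(0) = w_0 is positive. *)
  have LE : L = +oo%E.
    by rewrite /L tau_0 Phi0// (le0_lneNy (x := 0%E))// lne_EFin.
  rewrite LE; split; [|split; [|split => //]].
  - apply: cvg_lne_rate_y => // A A0.
    by apply: (lower _ (A + 1)) => //; [rewrite ltrDl|move=> z /Poo ->; rewrite ltry].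
  - rewrite (_ : ereal_inf _ = +oo%E)//; apply/eqP; rewrite -leye_eq.
    apply: le_ereal_inf_tmp => _ [t /= t0 <-].
    rewrite le_eqVlt in t0; case/predU1P: t0 => [<-|t0]; first by rewrite div0.
    by rewrite Poo// inver gt_eqF// gt0_mulye// lte_fin invr_gt0.
  - by rewrite rho_0 ltxx.
have LE : L = (ln B)%:E.
  rewrite /L PB !lne_EFin ?mulr_gt0// lnM ?posrE//.
  by rewrite -EFinB addrAC subrr add0r.
rewrite LE; split; [|split; [|split => //]].
- apply: (cvg_lne_rate _ _ tau) => //.
  + by move=> n; apply: esum_ge0 => t _; rewrite lee_fin tweight_ge0.
  + by move=> n; exact: Zn_le.
  (* [hB] is not strict, so y is taken as the midpoint of A and B. *)
  + move=> A A0 AB; apply: (lower _ ((A + B) / 2)) => //; first by lra.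
    move=> z z0; apply: lt_le_trans (hB _ (ltW z0)).
    by rewrite lte_fin ltr_pM2r//; lra.
- rewrite (_ : ereal_inf _ = B%:E); first by rewrite lne_EFin.
  apply/eqP; rewrite eq_le; apply/andP; split.
    apply: ereal_inf_lbound; exists tau => /=; first exact: ltW.
    by rewrite PB inver gt_eqF// -EFinM mulrAC divff ?mul1r// gt_eqF.
  apply: le_ereal_inf_tmp => _ [t /= t0 <-].
  have := t0; rewrite [(0 <= t)%R]le_eqVlt => /predU1P[<-|tgt0]; first by rewrite div0 leey.
  by rewrite inver gt_eqF// lee_pdivlMr// -EFinM hB.
(* Here rho >= tau > 0, so rho = 0 is contradictory. *)
- move=> rho0; have := le_rho w _ (ltW tau0).
  by rewrite PB ltry rho0 lee_fin leNgt tau0 => /(_ isT).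
Qed.
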